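(* Let $V=\mathbb{R}\times\mathbb{R}^3$, let $\|\mathbf{x}\|=|x_1|+|x_2|+|x_3|$ for $\mathbf x\in\mathbb R^3$, let $V^+=\{(t,\mathbf{x})\in V : t\ge \|\mathbf{x}\|\}$ and $e=(1,\mathbf{0})$. Put $\mathbf{a}_{(\pm1)}=(\pm\tfrac12,0,0)$, $\mathbf{a}_{(\pm2)}=(0,\pm\tfrac12,0)$, $\mathbf{a}_{(\pm3)}=(0,0,\pm\tfrac12)$ and $a_i=(\tfrac12,\mathbf{a}_{(i)})$ for $i\in\{\pm1,\pm2,\pm3\}$. Then the set of normalized extremal elements is $\partial^+V^+=\{a_{\pm1},a_{\pm2},a_{\pm3}\}$; for each $i$ the map $$a_i^\sharp\colon V\to V,\quad (t,\mathbf{x})\mapsto (t+2\mathbf{a}_{(i)}\cdot\mathbf{x})\,a_i$$ is a coherent Lüders's rule for $a_i$; and for every state $\omega$ and all $i,j\in\{\pm1,\pm2,\pm3\}$, $$\omega[a_i^\sharp(a_j)]=\omega(a_i)\cdot\begin{cases}1 & i=j,\\ 0 & i=-j,\\ \tfrac12 & \text{otherwise,}\end{cases}$$ i.e. these coherent Lüders's rules reproduce the state update rule of Spekkens's toy model.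
   Context: For $x,y\in V$ write $x\ge y$ iff $x-y\in V^+$. The order norm is $\|x\|=\inf\{r\ge 0: -re\le x\le re\}$ for $x\in V$. The set of normalized extremal elements is $\partial^+V^+=\{f\in V^+ : \|f\|=1\text{ and }(0\le g\le f\text{ implies } g=rf \text{ for some } r\ge0)\}$. A state is a linear functional $\omega\colon V\to\mathbb{R}$ with $\omega(e)=1$ and $\omega(V^+)\subset[0,\infty)$. A coherent Lüders's rule for an effect $f$ (an element with $0\le f\le e$) is a linear map $\phi\colon V\to V$ with $\phi(V^+)\subset V^+$, $\phi(e)=f$, and $\phi(g)=g$ for every $g\in V^+$ with $g\le f$. The quantity $\omega[a_i^\sharp(a_j)]$ is the probability $\mathbb{P}_\omega(a_i\rhd a_j)$ of obtaining first outcome $a_i$ and then outcome $a_j$, and the state update rule of Spekkens's toy model is the prescription that this probability is given by the displayed right-hand side. *)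

(* Defs.v *)
From HB Require Import structures.
From mathcomp Require Import all_boot all_order all_algebra.
From mathcomp Require Import boolp classical_sets reals.

Set Implicit Arguments.
Unset Strict Implicit.
Unset Printing Implicit Defensive.

Import Order.TTheory GRing.Theory Num.Theory.
Local Open Scope classical_set_scope.
Local Open Scope ring_scope.

Section OrderUnit.
Context (R : realType) (V : lmodType R).
Implicit Types (P : set V) (e f x y : V).

(* In this section P plays the role of the positive cone and e that of the
   order unit; the order is the one induced by P. *)
Definition cone_le P x y : Prop := P (y - x).

(* [inf] is the total operator of the reals library; it is the true infimum
   whenever the set is nonempty, i.e., whenever some multiple of e dominates
   x and - x. *)
Definition order_norm P e x : R :=
  inf [set r : R | 0 <= r /\
                   cone_le P (- (r *: e)) x /\ cone_le P x (r *: e)].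

Definition normalized_extremal P e : set V :=
  [set f | P f /\ order_norm P e f = 1 /\
     forall g : V, cone_le P 0 g -> cone_le P g f ->
       exists r : R, 0 <= r /\ g = r *: f].

Definition is_effect P e f : Prop := cone_le P 0 f /\ cone_le P f e.

Definition is_state P e (omega : V -> R) : Prop :=
  [/\ scalar omega, omega e = 1 & forall x : V, P x -> 0 <= omega x].

Definition coherent_luders P e f (phi : V -> V) : Prop :=
  is_effect P e f /\
  [/\ linear phi, forall x : V, P x -> P (phi x), phi e = f
    & forall g : V, P g -> cone_le P g f -> phi g = g].

End OrderUnit.

Definition toyV (R : realType) : lmodType R := (R^o * 'rV[R]_3)%type.

(* The canonical norm of 'rV[R]_3 in the library is the sup norm, hence the
   explicit definition of the 1-norm. *)
Definition norm1 (R : realType) (x : 'rV[R]_3) : R := \sum_(k < 3) `|x 0 k|.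

Definition dot (R : realType) (x y : 'rV[R]_3) : R :=
  \sum_(k < 3) x 0 k * y 0 k.

Definition toy_cone (R : realType) : set (toyV R) :=
  [set v | norm1 v.2 <= v.1].
Arguments toy_cone R : clear implicits.

Definition toy_unit (R : realType) : toyV R := (1, 0).

Definition toy_index : seq int := [:: 1; -1; 2; -2; 3; -3].

(* Coordinates are numbered from 0 in 'rV[R]_3, so that the coordinate
   affected by the index i is the one numbered |i| - 1. Only meaningful for
   i \in toy_index. *)
Definition toy_vec (R : realType) (i : int) : 'rV[R]_3 :=
  \row_(k < 3) (if k.+1 == `|i|%N then (sgz i)%:~R / 2 else 0).

Definition toy_atom (R : realType) (i : int) : toyV R :=
  (1 / 2, toy_vec R i).

Definition toy_sharp (R : realType) (i : int) (v : toyV R) : toyV R :=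
  (v.1 + 2 * dot (toy_vec R i) v.2) *: toy_atom R i.
Arguments toy_sharp R i v : clear implicits.

Definition toy_update (R : realType) (i j : int) : R :=
  if i == j then 1 else if i == - j then 0 else 1 / 2.

(* Main.v *)
Require Import Defs.
From HB Require Import structures.
From mathcomp Require Import all_boot all_order all_algebra.
From mathcomp Require Import boolp classical_sets reals.
From mathcomp Require Import lra.

Set Implicit Arguments.
Unset Strict Implicit.
Unset Printing Implicit Defensive.

Import Order.TTheory GRing.Theory Num.Theory.
Local Open Scope classical_set_scope.
Local Open Scope ring_scope.

(** For [v = (t, x)] the order norm is [|t| + |x|_1].  A cone element with
    [x_k <> 0] dominates [|x_k| (1, sgn(x_k) e_k)], a multiple of an atom, and
    one with [x = 0] dominates a multiple of [a_1]; so an extremal element is a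
    multiple of an atom.  Conversely [0 <= (s, y) <= a_i], with [a_i] pointing
    in direction [sigma e_k], forces
    [s + m <= sigma y_k <= |y_k| <= s - m], where [m] is the sum of the other
    [|y_l|]; hence [m = 0] and [(s, y) = 2 s a_i].  Thus [a_i] is extremal, and
    [a_i^#] fixes everything below [a_i] since it fixes [a_i]. *)

Section ToyModel.
Context (R : realType).
Implicit Types (x y : 'rV[R]_3) (v g : toyV R) (c s : R) (k : 'I_3) (i j : int).

(** * The 1-norm and the dot product in coordinates *)

Lemma scale_half c : c *: (1 / 2 : R^o) = c / 2.
Proof. by congr (c * _); exact: mul1r. Qed.

Lemma norm1D1 x k : norm1 x = `|x 0 k| + \sum_(l < 3 | l != k) `|x 0 l|.
Proof. by rewrite /norm1 (bigD1 k). Qed.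

Lemma norm1_ge_coord x k : `|x 0 k| <= norm1 x.
Proof. by rewrite (norm1D1 x k) lerDl sumr_ge0. Qed.

Lemma norm1_ge0 x : 0 <= norm1 x.
Proof. exact: sumr_ge0. Qed.

Lemma norm10 : norm1 (0 : 'rV[R]_3) = 0.
Proof. by rewrite /norm1 big1 // => l _; rewrite mxE normr0. Qed.

Lemma norm1N x : norm1 (- x) = norm1 x.
Proof. by apply: eq_bigr => l _; rewrite mxE normrN. Qed.

Lemma norm1Z c x : norm1 (c *: x) = `|c| * norm1 x.
Proof. by rewrite /norm1 mulr_sumr; apply: eq_bigr => l _; rewrite mxE normrM. Qed.

Lemma norm1_delta k : norm1 (delta_mx 0 k : 'rV[R]_3) = 1.
Proof.
rewrite (norm1D1 _ k) big1 ?mxE ?eqxx ?normr1 ?addr0 // => l lk.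
by rewrite mxE (negPf lk) andbF normr0.
Qed.

Lemma dot_delta c k x : dot (c *: delta_mx 0 k) x = c * x 0 k.
Proof.
rewrite /dot (bigD1 k) //= big1 ?mxE ?eqxx ?mulr1 ?addr0 // => l lk.
by rewrite !mxE (negPf lk) andbF mulr0 mul0r.
Qed.

Lemma dot_linear y c x x' : dot y (c *: x + x') = c * dot y x + dot y x'.
Proof.
rewrite /dot mulr_sumr -big_split; apply: eq_bigr => l _ /=.
by rewrite !mxE mulrDr mulrCA.
Qed.

(** * The cone and its order norm *)

Lemma toy_cone_le0 v : cone_le (toy_cone R) 0 v = toy_cone R v.
Proof. by rewrite /cone_le subr0. Qed.

Lemma toy_coneZ c v : 0 <= c -> toy_cone R v -> toy_cone R (c *: v).
Proof.
by move=> c0; rewrite /toy_cone/= norm1Z ger0_norm // => ?; rewrite ler_wpM2l.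
Qed.

Lemma sym_interval_le (t n r : R) : 0 <= n ->
  (0 <= r /\ n <= t + r /\ n <= r - t) <-> `|t| + n <= r.
Proof.
move=> n0; have [t0|t0] := leP 0 t;
  [rewrite ger0_norm // | rewrite ltr0_norm //];
  by split => [[? []]|?]; [|split; [|split]]; lra.
Qed.

(** The set under the infimum is the closed half-line starting at the right-hand side, by
    [sym_interval_le]; so the infimum is attained. *)
Lemma toy_order_norm v :
  order_norm (toy_cone R) (toy_unit R) v = `|v.1| + norm1 v.2.
Proof.
rewrite /order_norm; set S := (X in inf X).
have SP r : S r <-> `|v.1| + norm1 v.2 <= r.
  rewrite /S {S} /cone_le /toy_cone /= !scaler0 oppr0 subr0 sub0r norm1N.
  have -> : r *: (1 : R^o) = r by exact: mulr1.
  by rewrite opprK; exact: (@sym_interval_le v.1 _ r (norm1_ge0 v.2)).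
have S0 : S (`|v.1| + norm1 v.2) by apply/SP.
apply/eqP; rewrite eq_le; apply/andP; split.
  by apply: ge_inf => //; exists (`|v.1| + norm1 v.2) => r /SP.
by apply: lb_le_inf; [exists (`|v.1| + norm1 v.2)|move=> r /SP].
Qed.

Lemma toy_order_normZ c v :
  order_norm (toy_cone R) (toy_unit R) (c *: v) =
  `|c| * order_norm (toy_cone R) (toy_unit R) v.
Proof.
by rewrite !toy_order_norm/= norm1Z mulrDr -normrM.
Qed.

(** * Atoms indexed by a real sign and a coordinate *)

Definition axis_atom s k : toyV R := (1 / 2, (s / 2) *: delta_mx 0 k).

Lemma toy_atom_axis i : i \in toy_index ->
  exists s k, `|s| = 1 /\ toy_atom R i = axis_atom s k.
Proof.
move=> iI; exists (sgz i)%:~R, (inord `|i|.-1); split.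
  by move: iI; rewrite !inE => /or4P[|||/or3P[]] /eqP->;
    rewrite ?normrN ?normr1.
congr (_, _); apply/rowP => l; rewrite !mxE eqxx/= -val_eqE/=.
have i3 : (0 < `|i| <= 3)%N.
  by move: iI; rewrite !inE => /or4P[|||/or3P[]] /eqP->.
rewrite inordK; last by case: `|i|%N i3.
(* The shift between coordinates from 0 and indices from 1 is sound because [i] is nonzero. *)
have -> : (l == `|i|.-1 :> nat) = (l.+1 == `|i|%N) by case: `|i|%N i3.
by case: ifP => _; rewrite ?mulr1 ?mulr0.
Qed.

Lemma axis_atom_toy s k : `|s| = 1 ->
  exists2 i, i \in toy_index & axis_atom s k = toy_atom R i.
Proof.
have kI : (k.+1%:Z \in toy_index) && (- k.+1%:Z \in toy_index).
  by case: k => [[|[|[|]]]].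
have [kI1 kI2] := andP kI.
move=> /eqP; rewrite eqr_norml ler01 andbT => /orP[] /eqP->.
  exists k.+1%:Z => //; congr (_, _); apply/rowP => l.
  rewrite !mxE eqxx/= eqSS -val_eqE/=.
  by case: ifP => _; rewrite ?mulr1 ?mulr0.
exists (- k.+1%:Z) => //; congr (_, _); apply/rowP => l.
rewrite !mxE eqxx/= eqSS -val_eqE/=.
by case: ifP => _; rewrite ?mulr1 ?mulr0.
Qed.

Lemma axis_atom_cone s k : `|s| = 1 -> toy_cone R (axis_atom s k).
Proof.
move=> s1; rewrite /toy_cone/= norm1Z norm1_delta (normrM s) s1 normfV.
rewrite gtr0_norm //; lra.
Qed.

Lemma axis_atom_norm s k : `|s| = 1 ->
  order_norm (toy_cone R) (toy_unit R) (axis_atom s k) = 1.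
Proof.
move=> s1; rewrite toy_order_norm/= norm1Z norm1_delta (normrM s) s1 normfV.
rewrite !ger0_norm //; lra.
Qed.

Lemma below_axis_atom s k g : `|s| = 1 -> toy_cone R g ->
  cone_le (toy_cone R) g (axis_atom s k) ->
  exists2 r : R, 0 <= r & g = r *: axis_atom s k.
Proof.
case: g => t0 y s1; pose t : R := t0; rewrite -[t0]/t; move: t => {}t.
rewrite /cone_le /toy_cone /axis_atom /=.
rewrite !(norm1D1 _ k) !mxE !eqxx/= mulr1.
set m := \sum_(l < 3 | _) `|y 0 l|; set m' := (X in _ + X <= 1 / 2 - t).
have -> : m' = m.
  by apply: eq_bigr => l lk; rewrite !mxE (negPf lk) mulr0 sub0r normrN.
move=> g0 ga.
have m0 : 0 <= m by exact: sumr_ge0.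
have ss : s * s = 1 by rewrite -expr2 -real_normK ?num_real // s1 expr1n.
have sy : s * y 0 k <= `|y 0 k| by rewrite -[leRHS]mul1r -s1 -normrM ler_norm.
(* Multiplying by [s] keeps the absolute value and turns [s / 2] into [1 / 2]. *)
have ay : 1 / 2 - s * y 0 k <= `|s / 2 - y 0 k|.
  have -> : `|s / 2 - y 0 k| = `|s * (s / 2 - y 0 k)| by rewrite normrM s1 mul1r.
  by apply: le_trans (ler_norm _); rewrite mulrBr mulrA ss.
have mE : m = 0 by lra.
have yk : y 0 k = t * s by rewrite -[LHS]mul1r -ss -mulrA mulrC; congr (_ * _); lra.
(* The factor 2 compensates the first component [1 / 2] of the atom. *)
exists (2 * t); first by have := normr_ge0 (y 0 k); lra.
congr (_, _); first by rewrite /= /GRing.scale /=; lra.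
apply/rowP => l; rewrite !mxE eqxx/=; have [->|lk] := eqVneq l k.
  by rewrite yk mulr1; lra.
rewrite !mulr0; apply/normr0_eq0/(@psumr_eq0P _ _ _ (fun l => `|y 0 l|) _ mE) => //.
Qed.

(** * Extremal elements are exactly the atoms *)

Lemma axis_atom_extremal s k : `|s| = 1 ->
  normalized_extremal (toy_cone R) (toy_unit R) (axis_atom s k).
Proof.
move=> s1; split; first exact: axis_atom_cone.
split; first exact: axis_atom_norm.
move=> g; rewrite toy_cone_le0 => g0 /(below_axis_atom s1 g0)[r r0 ->].
by exists r.
Qed.

(** Extremality gives [c *: axis_atom s k = r *: f]. Both vectors have order norm 1, so [r = c], and
    [c] cancels. *)
Lemma extremal_dominating s k c f : `|s| = 1 -> 0 < c ->
  normalized_extremal (toy_cone R) (toy_unit R) f ->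
  cone_le (toy_cone R) (c *: axis_atom s k) f -> f = axis_atom s k.
Proof.
move=> s1 c0 [f0 [f1 fext]] le_f.
have cf0 : toy_cone R (c *: axis_atom s k).
  by apply: toy_coneZ; [exact: ltW|exact: axis_atom_cone].
have [|r [r0 rE]] := fext (c *: axis_atom s k) _ le_f; first by rewrite toy_cone_le0.
have rc : r = c.
  have := toy_order_normZ c (axis_atom s k).
  rewrite rE toy_order_normZ f1 axis_atom_norm // !mulr1.
  by rewrite (ger0_norm r0) (gtr0_norm c0).
by move: rE; rewrite rc => /(scalerI (lt0r_neq0 c0)).
Qed.

(** The multiple is chosen so that subtracting it annihilates coordinate [k] and lowers both the
    first component and the 1-norm by [|x_k|]. *)
Lemma cone_dominates_axis_atom (t : R) x k : norm1 x <= t ->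
  cone_le (toy_cone R) ((2 * `|x 0 k|) *: axis_atom (Num.sg (x 0 k)) k) (t, x).
Proof.
rewrite /cone_le /toy_cone /= !(norm1D1 _ k) !mxE !eqxx/= mulr1.
set m := \sum_(l < 3 | _) `|x 0 l|; set m' := (X in _ + X <= _ - _).
have -> : m' = m.
  by apply: eq_bigr => l lk; rewrite !mxE (negPf lk) !mulr0 subr0.
have -> : x 0 k - 2 * `|x 0 k| * (Num.sg (x 0 k) / 2) = 0.
  by rewrite [X in X - _]numEsg; lra.
rewrite normr0 scale_half; lra.
Qed.

(** The difference has first component [t / 2] and 1-norm [t / 2], hence lies on the boundary of the
    cone. *)
Lemma cone_dominates_axis_atom0 (t : R) k : 0 <= t ->
  cone_le (toy_cone R) (t *: axis_atom 1 k) (t, 0).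
Proof.
move=> t0; rewrite /cone_le /toy_cone /= sub0r norm1N !norm1Z norm1_delta.
rewrite scale_half !ger0_norm //; lra.
Qed.

Lemma extremal_axis_atom f :
  normalized_extremal (toy_cone R) (toy_unit R) f ->
  exists s k, `|s| = 1 /\ f = axis_atom s k.
Proof.
case: f => t x fE; have [f0 [f1 _]] := fE.
have [x0|] := eqVneq x 0; last first.
  move=> /eqP x0; have [k xk] : exists k, x 0 k != 0.
    apply/not_existsP => xE; apply: x0; apply/rowP => k; rewrite mxE.
    by apply/eqP/negPn/negP/xE.
  have s1 : `|Num.sg (x 0 k)| = 1 by rewrite normr_sg xk.
  exists (Num.sg (x 0 k)), k; split=> //.
  apply: (@extremal_dominating _ _ (2 * `|x 0 k|)) => //.
    by rewrite mulr_gt0 ?normr_gt0.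
  exact: cone_dominates_axis_atom.
(* Here [f] would be the order unit, which is not extremal. No contradiction has to be drawn:
   domination of an atom already yields the goal. *)
have t1 : t = 1.
  move: f0 f1; rewrite toy_order_norm /toy_cone /= x0 norm10 addr0 => t0.
  by rewrite ger0_norm.
exists 1, 0; split; first exact: normr1.
apply: (@extremal_dominating _ _ 1) => //; first exact: normr1.
rewrite x0 t1; exact: cone_dominates_axis_atom0.
Qed.

(** * Lüders's rules and the update rule *)

Lemma toy_sharp_luders i : i \in toy_index ->
  coherent_luders (toy_cone R) (toy_unit R) (toy_atom R i) (toy_sharp R i).
Proof.
move=> /toy_atom_axis[s [k [s1 aE]]].
have vE : toy_vec R i = (s / 2) *: delta_mx 0 k by case: aE.
rewrite /toy_sharp aE vE.
have ss : s * s = 1 by rewrite -expr2 -real_normK ?num_real // s1 expr1n.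
split; split.
- by rewrite toy_cone_le0; exact: axis_atom_cone.
(* The complement of an atom in the unit is the opposite atom, with the same 1-norm. *)
- rewrite /cone_le /toy_cone/= sub0r norm1N.
  have := axis_atom_cone k s1; rewrite /toy_cone /=; lra.
- move=> c u v /=; rewrite scalerA -scalerDl dot_linear; congr (_ *: _).
  by rewrite !mulrDr mulrCA addrACA.
- move=> v v0; apply: toy_coneZ; last exact: axis_atom_cone.
  (* The coefficient is [t + s * x_k], at least [t - |x_k|], which is nonnegative on the cone. *)
  rewrite dot_delta; have := norm1_ge_coord v.2 k.
  have : - (s * v.2 0 k) <= `|v.2 0 k|.
    by rewrite -[leRHS]mul1r -s1 -normrM -normrN ler_norm.
  move: v0; rewrite /toy_cone/=; lra.
- by rewrite dot_delta mxE !mulr0 addr0 scale1r.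
(* Such a [g] is a multiple of the atom, and the atom is fixed because its coefficient is
   [1 / 2 + s * s / 2 = 1]. *)
move=> g g0 /(below_axis_atom s1 g0)[r _ ->].
rewrite dot_delta !mxE !eqxx /= scale_half; congr (_ *: _).
have -> : s / 2 * (r * (s / 2 * 1)) = s * s * r / 4 by lra.
by rewrite ss; lra.
Qed.

(** Twice the dot product is [1 / 2] for equal indices, [- 1 / 2] for opposite ones and 0 on
    different axes; all 36 pairs are checked. *)
Lemma toy_update_dot i j : i \in toy_index -> j \in toy_index ->
  toy_update R i j = 1 / 2 + 2 * dot (toy_vec R i) (toy_vec R j).
Proof.
rewrite /dot !big_ord_recl big_ord0 !mxE /toy_update.
have sgE : (sgz (1 : int) = 1) * (sgz (-1 : int) = -1) * (sgz (2 : int) = 1) *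
  (sgz (-2 : int) = -1) * (sgz (3 : int) = 1) * (sgz (-3 : int) = -1) by [].
by rewrite !inE => /or4P[|||/or3P[]] /eqP-> /or4P[|||/or3P[]] /eqP->;
  rewrite !sgE /= ?mulrN1z; lra.
Qed.

Lemma toy_update_atoms i j : i \in toy_index -> j \in toy_index ->
  toy_sharp R i (toy_atom R j) = toy_update R i j *: toy_atom R i.
Proof. by move=> iI jI; rewrite /toy_sharp toy_update_dot. Qed.

End ToyModel.

Theorem mainTheorem2 (R : realType) :
  normalized_extremal (toy_cone R) (toy_unit R) =
    [set toy_atom R i | i in [set i : int | i \in toy_index]] /\
  (forall i : int, i \in toy_index ->
    coherent_luders (toy_cone R) (toy_unit R) (toy_atom R i)
      (toy_sharp R i)) /\
  (forall omega : toyV R -> R, is_state (toy_cone R) (toy_unit R) omega ->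
    forall i j : int, i \in toy_index -> j \in toy_index ->
      omega (toy_sharp R i (toy_atom R j)) =
        omega (toy_atom R i) * toy_update R i j).
Proof.
split; [|split].
- apply/seteqP; split=> f.
    move=> /extremal_axis_atom[s [k [s1 ->]]].
    by have [i iI ->] := axis_atom_toy k s1; exists i.
  move=> [i /= iI <-]; have [s [k [s1 ->]]] := toy_atom_axis R iI.
  exact: axis_atom_extremal.
- exact: toy_sharp_luders.
move=> omega [omega_lin _ _] i j iI jI; rewrite toy_update_atoms //.
(* [scalar] is the single law [omega (c *: x + y) = c * omega x + omega y]: taking [c = -1] at 0
   gives [omega 0 = 0], and then [y = 0] gives homogeneity. *)
have o0 : omega 0 = 0.
  by have := omega_lin (-1) 0 0; rewrite scaler0 addr0 => ->; rewrite mulN1r addNr.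
by have := omega_lin (toy_update R i j) (toy_atom R i) 0; rewrite !addr0 o0 addr0 mulrC.
Qed.
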